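(* Let $G$ be a group. Then $\mathrm{Univ}(G)=\{1\}$ if and only if $Z(G)=\{1\}$.
   Context: For a group $G$ and $x,y\in G$, write $x\to y$ if $\langle x\rangle$ is normal in $\langle x,y\rangle$, and $x\leftrightarrow y$ if both $x\to y$ and $y\to x$. $\mathrm{Univ}(G)$ is the set of all $x\in G$ such that $x\leftrightarrow y$ for every $y\in G$. $Z(G)$ is the center of $G$. *)

(* Defs.v *)
From mathcomp Require Import all_boot classical_sets.

Set Implicit Arguments.
Unset Strict Implicit.
Unset Printing Implicit Defensive.

Local Open Scope classical_set_scope.
Local Open Scope group_scope.

(* Groups are MathComp's [groupType], which are not assumed finite; subsets are
   Prop-valued, so that membership in a subgroup need not be decidable. *)

Definition is_subgroup (G : groupType) (H : set G) : Prop :=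
  H 1 /\ forall x y, H x -> H y -> H (x / y).

Definition generated (G : groupType) (A : set G) : set G :=
  smallest (@is_subgroup G) A.

(* [x ^ y] is the conjugate [y^-1 * (x * y)]. *)
Definition is_normal_in (G : groupType) (N H : set G) : Prop :=
  [/\ is_subgroup N, N `<=` H & forall n h, N n -> H h -> N (n ^ h)].

Definition arrow (G : groupType) (x y : G) : Prop :=
  is_normal_in (generated [set x]) (generated [set x; y]).

Definition biarrow (G : groupType) (x y : G) : Prop :=
  arrow x y /\ arrow y x.

Definition Univ (G : groupType) : set G :=
  [set x | forall y, biarrow x y].
Arguments Univ G : clear implicits.

Definition center (G : groupType) : set G :=
  [set z | forall x, commute z x].
Arguments center G : clear implicits.

(* Main.v *)
Require Import Defs.
From mathcomp Require Import all_boot classical_sets.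
Local Open Scope classical_set_scope.
Local Open Scope group_scope.

(** Central elements are universal since commuting elements normalise each
    other's cyclic subgroups. Conversely, let x be universal. For every y, the
    commutator [x, y] is a power x^u (u an integer) lying in <y>, hence fixed
    by y; as x^y = x^(1+u), this forces x^(u^2) = 1. If also [x, z] = x^v, then
    x^(v^2) = 1, and gcd(u^2, v^2) divides uv, so x^(uv) = 1, which says that
    z fixes x^u. Thus [x, y] is central; when the center is trivial, x itself
    is then central, hence trivial. *)

(** Bezout in the subtraction-free form [a * m = b * n + gcdn m n], available for positive [m],
    keeps all exponents natural. *)
Lemma expg_eq1_gcdn (G : groupType) (x : G) (m n : nat) :
  x ^+ m = 1 -> x ^+ n = 1 -> x ^+ gcdn m n = 1.
Proof.
have [-> _|m_gt0 xm xn] := posnP m; first by rewrite gcd0n.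
case: (egcdnP n m_gt0) => a b bezout _.
have := congr1 (fun k => x ^+ k) bezout.
by rewrite /= expgnDr (mulnC a) (mulnC b) !expgnA xm xn !expg1n mul1g => <-.
Qed.

Lemma gcdn_sqr_dvdn_mul (u v : nat) : gcdn (u * u) (v * v) %| u * v.
Proof.
(* Divisibility may be tested on squares: one copy of the gcd divides [u * u], the other [v * v]. *)
rewrite -(@dvdn_pexp2r _ _ 2) // -!mulnn mulnACA.
by rewrite dvdn_mul // (dvdn_gcdl, dvdn_gcdr).
Qed.

Lemma expg_mul_eq1 (G : groupType) (x : G) (u v : nat) :
  x ^+ (u * u) = 1 -> x ^+ (v * v) = 1 -> x ^+ (u * v) = 1.
Proof.
move=> xu xv; have /dvdnP[k ->] := gcdn_sqr_dvdn_mul u v.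
by rewrite mulnC expgnA expg_eq1_gcdn // expg1n.
Qed.

Lemma generated_subgroup (G : groupType) (A : set G) :
  is_subgroup (generated A).
Proof.
split=> [H [[]] //|x y Ax Ay H HA]; have [[_ Hdiv] _] := HA.
by apply: Hdiv; [apply: Ax | apply: Ay].
Qed.

Lemma is_subgroupV (G : groupType) (H : set G) (x : G) :
  is_subgroup H -> H x -> H x^-1.
Proof. by case=> H1 Hdiv Hx; rewrite -div1g; apply: Hdiv. Qed.

Lemma is_subgroupM (G : groupType) (H : set G) (x y : G) :
  is_subgroup H -> H x -> H y -> H (x * y).
Proof.
move=> sgH Hx Hy; rewrite -(invgK y).
by apply: sgH.2 => //; apply: is_subgroupV.
Qed.

Lemma centralizer_subgroup (G : groupType) (A : set G) :
  is_subgroup [set g | forall a, A a -> commute a g].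
Proof.
split=> [a _|x y cx cy a Aa]; first exact: commute1.
by apply: commuteM; [apply: cx | apply: commuteV; apply: cy].
Qed.

Lemma generated_commute (G : groupType) (A B : set G) :
  (forall a b, A a -> B b -> commute a b) ->
  forall g h, generated A g -> generated B h -> commute g h.
Proof.
move=> cAB g h Ag Bh.
(* Centralizers are subgroups, so commutation extends from generators: first from [B] to
   [generated B], then, with [h] fixed, from [A] to [generated A]. *)
have cAh a : A a -> commute a h.
  suff : generated B `<=` [set h | forall a, A a -> commute a h] by apply.
  apply: smallest_sub; first exact: centralizer_subgroup.
  by move=> b Bb a' Aa'; apply: cAB.
suff : generated A `<=` [set g | forall b, b = h -> commute b g].
  by move/(_ g Ag h erefl)/commute_sym.
apply: smallest_sub; first exact: centralizer_subgroup.
by move=> a Aa _ ->; apply/commute_sym/cAh.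
Qed.

Lemma generated1P (G : groupType) (x g : G) : generated [set x] g ->
  exists u, g = x ^+ u \/ g = x ^- u.
Proof.
(* Quotients of natural powers are closed under division; the sign is settled afterwards by
   comparing the exponents. *)
move=> xg; have [m [n ->]] : exists m n, g = x ^+ m / x ^+ n.
  suff : generated [set x] `<=` [set g | exists m n, g = x ^+ m / x ^+ n].
    by apply.
  apply: smallest_sub => [|_ ->]; last by exists 1%N, 0%N; rewrite divg1.
  split=> [|_ _ [m [n ->]] [p [q ->]]]; first by exists 0%N, 0%N; rewrite divg1.
  exists (m + q)%N, (p + n)%N; rewrite invgF !expgnDr invgM !mulgA.
  congr (_ / _); rewrite -!mulgA; congr (_ * _).
  by apply/commute_sym/commuteV/commuteX2.
have [le_nm|/ltnW le_mn] := leqP n m.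
  by exists (m - n); left; rewrite expgnFr.
by exists (n - m); right; rewrite expgnFr // invgF.
Qed.

Lemma commute_arrow (G : groupType) (x y : G) : commute x y -> arrow x y.
Proof.
move=> cxy; split; first exact: generated_subgroup.
  apply: smallest_sub; first exact: generated_subgroup.
  by move=> _ ->; apply: sub_gen_smallest; left.
move=> n h xn xyh; suff /commgP/conjg_fixP -> : commute n h by [].
by apply: generated_commute xn xyh => _ b -> [] ->.
Qed.

Lemma center_Univ (G : groupType) : center G `<=` Univ G.
Proof.
move=> z cz y; split; apply: commute_arrow; first exact: cz.
exact/commute_sym/cz.
Qed.

(** The commutator is [x^-1 * x ^ y], and normality puts the second factor in the subgroup generated
    by [x]. *)
Lemma arrow_commg (G : groupType) (x y : G) :
  arrow x y -> generated [set x] [~ x, y].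
Proof.
case=> sgx _ nx; have xx : generated [set x] x by apply: sub_gen_smallest.
have xyy : generated [set x; y] y by apply: sub_gen_smallest; right.
rewrite commgEl.
exact: is_subgroupM sgx (is_subgroupV _ _ _ sgx xx) (nx _ _ xx xyy).
Qed.

Lemma biarrow_commg (G : groupType) (x y : G) : biarrow x y ->
  exists u, ([~ x, y] = x ^+ u \/ [~ x, y] = x ^- u) /\ x ^+ (u * u) = 1.
Proof.
case=> xy yx; have [u xyu] := generated1P _ _ _ (arrow_commg _ _ _ xy).
exists u; split=> //.
have cyc : commute [~ x, y] y.
  (* [[~ x, y]] is the inverse of [[~ y, x]], which [arrow y x] places among the powers of [y]. *)
  have yc : generated [set y] [~ x, y].
    rewrite -invgR; have sgy := generated_subgroup _ [set y].
    exact: is_subgroupV sgy (arrow_commg _ _ _ yx).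
  apply: (generated_commute _ [set y] [set y]) yc _ => [_ _ -> ->//|].
  exact: sub_gen_smallest.
have cyu : commute (x ^+ u) y.
  case: xyu => eqc; first by rewrite -eqc.
  by apply/commute_sym; rewrite -[x ^+ u]invgK -eqc; apply/commuteV/commute_sym.
have cxc : commute x [~ x, y].
  by case: xyu => ->; [|apply: commuteV]; apply: commuteX.
(* Since [x] commutes with [[~ x, y]], the [u]-th power of [x ^ y = x * [~ x, y]] splits; as [y]
   fixes [x ^+ u], that factor cancels. *)
have cu1 : [~ x, y] ^+ u = 1.
  apply: (mulgI (x ^+ u)); rewrite -expgMn // mulg1.
  by rewrite commgEl mulVKg -conjXg; apply/conjg_fixP/commgP.
case: xyu cu1 => ->; rewrite ?expVgn -expgnA // => /(canRL (@invgK _)) ->.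
exact: invg1.
Qed.

Lemma Univ_commg_center (G : groupType) (x y : G) :
  Univ G x -> center G [~ x, y].
Proof.
move=> Ux z; have [u [xyu xuu]] := biarrow_commg _ _ _ (Ux y).
have [v [xzv xvv]] := biarrow_commg _ _ _ (Ux z).
have cxz : commute x [~ x, z].
  by case: xzv => ->; [|apply: commuteV]; apply: commuteX.
have xzu1 : [~ x, z] ^+ u = 1.
  by case: xzv => ->; rewrite ?expVgn -expgnA expg_mul_eq1 ?invg1.
have czu : commute z (x ^+ u).
  apply/commute_sym/commgP/conjg_fixP.
  (* The same splitting, now read backwards: [[~ x, z] ^+ u = 1] gives that [z] fixes [x ^+ u]. *)
  by rewrite conjXg -[x ^ z](mulVKg x) -commgEl expgMn // xzu1 mulg1.
by apply: commute_sym; case: xyu => -> //; apply: commuteV.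
Qed.

Theorem corollary3p4 (G : groupType) :
  Univ G = [set 1] <-> center G = [set 1].
Proof.
have Z1 : center G 1 by move=> x; apply/commute_sym/commute1.
split=> [U1|C1]; apply/seteqP; split=> x.
- by move/center_Univ; rewrite U1.
- by move=> ->.
- move=> Ux; rewrite -C1 => y; apply/commgP/eqP.
  by have := Univ_commg_center _ _ y Ux; rewrite C1.
- by move=> ->; apply: center_Univ.
Qed.
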